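(* Let $n>1$ be an integer and let $p_1,p_2,\dots,p_n$ be distinct primes. There exist positive integers $l_1,\dots,l_n$, depending only on $p_1,\dots,p_n$, such that for every $n$-tuple of integers $m_1\ge l_1,\ m_2\ge l_2,\dots,\ m_n\ge l_n$ there exists a simple left brace of order $p_1^{m_1}p_2^{m_2}\cdots p_n^{m_n}$ whose multiplicative group is metabelian and has all its Sylow subgroups abelian.
   Context: A left brace is a set $B$ with two binary operations $+$ and $\cdot$ such that $(B,+)$ is an abelian group, $(B,\cdot)$ is a group, and $a\cdot(b+c)+a=a\cdot b+a\cdot c$ for all $a,b,c\in B$. For $a,b\in B$ put $\lambda_a(b)=ab-a$; then $\lambda_a\in\mathrm{Aut}(B,+)$. A left ideal of $B$ is a subgroup $L$ of $(B,+)$ with $\lambda_b(L)\subseteq L$ for all $b\in B$; an ideal is a left ideal that is also a normal subgroup of $(B,\cdot)$. A left brace $B$ is simple if $B\neq 0$ and its only ideals are $0$ and $B$. The order of $B$ is $|B|$. A group is metabelian if its derived length is at most $2$. *)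

(* Defs.v *)
From HB Require Import structures.
From mathcomp Require Import all_boot all_order all_algebra all_fingroup all_solvable.
Set Implicit Arguments. Unset Strict Implicit. Unset Printing Implicit Defensive.

Local Open Scope group_scope.

(* A finite left brace is represented by a finite group (gT, .) (the
   multiplicative group, the whole type gT) together with an additive
   structure (add, opp, zero) on the same carrier. *)

Definition is_left_brace (gT : finGroupType) (add : gT -> gT -> gT)
    (opp : gT -> gT) (zero : gT) : Prop :=
  [/\ (forall a b c, add a (add b c) = add (add a b) c),
      (forall a b, add a b = add b a),
      (forall a, add zero a = a),
      (forall a, add (opp a) a = zero) &
      (forall a b c, add (a * add b c) a = add (a * b) (a * c))].

Definition brace_lambda (gT : finGroupType) (add : gT -> gT -> gT)
    (opp : gT -> gT) (a b : gT) : gT := add (a * b) (opp a).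

Definition add_subgroup (gT : finGroupType) (add : gT -> gT -> gT)
    (opp : gT -> gT) (zero : gT) (L : {set gT}) : Prop :=
  [/\ zero \in L,
      (forall x y, x \in L -> y \in L -> add x y \in L) &
      (forall x, x \in L -> opp x \in L)].

Definition left_ideal (gT : finGroupType) (add : gT -> gT -> gT)
    (opp : gT -> gT) (zero : gT) (L : {set gT}) : Prop :=
  add_subgroup add opp zero L /\
  (forall b x, x \in L -> brace_lambda add opp b x \in L).

Definition brace_ideal (gT : finGroupType) (add : gT -> gT -> gT)
    (opp : gT -> gT) (zero : gT) (L : {set gT}) : Prop :=
  [/\ left_ideal add opp zero L, group_set L & L <| [set: gT]].

Definition simple_brace (gT : finGroupType) (add : gT -> gT -> gT)
    (opp : gT -> gT) (zero : gT) : Prop :=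
  1 < #|gT| /\
  (forall L : {set gT}, brace_ideal add opp zero L ->
     L = [set zero] \/ L = [set: gT]).

Definition metabelian_group (gT : finGroupType) : Prop :=
  ([set: gT]^`(2) = 1).

Definition sylows_abelian (gT : finGroupType) : Prop :=
  forall (p : nat) (P : {group gT}), P \in 'Syl_p([set: gT]) -> abelian P.

(* Main.v *)
Require Import Defs.
From HB Require Import structures.
From mathcomp Require Import all_boot all_order all_algebra all_fingroup all_solvable.

(* The braces are asymmetric products.  Let S act on T by automorphisms
   (both abelian groups) and let b : T x T -> S be an S-invariant symmetric
   bilinear form; the group T >< S with the addition
   (t, s) + (t', s') = (t + t', s + s' + b(t, t')) is a left brace.  An ideal
   containing (t, s) contains b(t, T), and one containing (0, s) contains
   (s - 1)T.

   Take a digraph whose vertices v carry primes, each edge joining distinct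
   primes.  Let S be the sum of the F_(p v) over the vertices, and T the sum
   over the edges v -> w of the zero-sum functions F_(p v) -> F_(p w), of
   dimension p v - 1 over F_(p w); the v-component of S acts on such a block by
   translations, b is the standard scalar product with values in the w-component
   of S.  Nontrivial translations fix only 0 and the scalar product is
   nondegenerate, so a nonzero ideal meeting vertex v contains the component of
   every successor of v: strong connectivity gives simplicity.

   With k_i vertices of prime p_i and N_i edges from layer i - 1 to layer i
   (cyclically), the p_i-part of the order has exponent
   k_i + (p_(i-1) - 1) N_i.  Every large m_i has this form with
   1 <= k_i <= p_(i-1) - 1 and N_i >= k_(i-1) k_i, which is enough to join all
   pairs of vertices in consecutive layers. *)

Set Implicit Arguments. Unset Strict Implicit. Unset Printing Implicit Defensive.
Import GRing.Theory.
Local Open Scope ring_scope.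

Lemma mulrn_coprime_eq0 (V : zmodType) (x : V) m n :
  coprime m n -> x *+ m = 0 -> x *+ n = 0 -> x = 0.
Proof.
case: (posnP m) => [-> | m_gt0 co_mn xm xn].
  by rewrite /coprime gcd0n => /eqP ->.
have [u v def_u _] := egcdnP n m_gt0.
rewrite -[x]mulr1n -(eqP co_mn).
have := congr1 (GRing.natmul x) def_u.
by rewrite mulrnDr (mulnC u) (mulnC v) !mulrnA xm xn !mul0rn add0r => <-.
Qed.

(** * Asymmetric products *)

Record asym_datum (T S : finZmodType) := AsymDatum {
  act : S -> T -> T;
  form : T -> T -> S;
  act0 : forall t, act 0 t = t;
  actD : forall s s' t, act (s + s') t = act s (act s' t);
  act_addr : forall s t t', act s (t + t') = act s t + act s t';
  formC : forall t t', form t t' = form t' t;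
  formDl : forall t1 t2 t, form (t1 + t2) t = form t1 t + form t2 t;
  form_act : forall s t t', form (act s t) (act s t') = form t t'
}.

(** The datum [A] is a phantom parameter: the alias carries the semidirect product determined by
    [A], kept apart from the componentwise structures on [T * S]. *)
Definition asym (T S : finZmodType) (A : asym_datum T S) : Type := T * S.

Section AsymmetricProduct.
Variables (T S : finZmodType) (A : asym_datum T S).
Local Notation G := (asym A).
Local Notation el t s := ((t%R, s%R) : G).
Local Notation act := (act A).
Local Notation form := (form A).

HB.instance Definition _ := Finite.copy G (T * S)%type.

Lemma act0r s : act s 0 = 0.
Proof. by apply: (addrI (act s 0)); rewrite -act_addr !addr0. Qed.

Lemma act_mulrn s t n : act s (t *+ n) = act s t *+ n.
Proof. by elim: n => [|n IHn]; rewrite ?act0r // !mulrS act_addr IHn. Qed.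

Lemma form0l t : form 0 t = 0.
Proof. by apply: (addrI (form 0 t)); rewrite -formDl !addr0. Qed.

Lemma formNl t t' : form (- t) t' = - form t t'.
Proof. by apply: (addrI (form t t')); rewrite -formDl !subrr form0l. Qed.

Lemma formDr t t1 t2 : form t (t1 + t2) = form t t1 + form t t2.
Proof. by rewrite formC formDl !(formC _ t). Qed.

Lemma formNr t t' : form t (- t') = - form t t'.
Proof. by rewrite formC formNl formC. Qed.

Definition asym_mul (x y : G) : G := (x.1 + act x.2 y.1, x.2 + y.2).
Definition asym_one : G := (0, 0).
Definition asym_inv (x : G) : G := (- act (- x.2) x.1, - x.2).

Fact asym_mulA : associative asym_mul.
Proof.
by move=> x y z; rewrite /asym_mul /= act_addr actD !addrA.
Qed.

Fact asym_mul1 : left_id asym_one asym_mul.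
Proof. by move=> [t s]; rewrite /asym_mul /= act0 !add0r. Qed.

Fact asym_mulV : left_inverse asym_one asym_inv asym_mul.
Proof. by move=> [t s]; rewrite /asym_mul /= !addNr. Qed.

HB.instance Definition _ :=
  Finite_isGroup.Build G asym_mulA asym_mul1 asym_mulV.

Definition asym_add (x y : G) : G := (x.1 + y.1, x.2 + y.2 + form x.1 y.1).
Definition asym_opp (x : G) : G := (- x.1, form x.1 x.1 - x.2).

Lemma asym_is_left_brace : is_left_brace asym_add asym_opp asym_one.
Proof.
split.
- move=> a b c; congr pair; rewrite /= ?addrA // formDl formDr !addrA.
  by rewrite [LHS](ACl (1*2*5*3*6*4)).
- by move=> a b; rewrite /asym_add formC (addrC a.1) (addrC a.2).
- by move=> [t s]; rewrite /asym_add /= form0l !add0r addr0.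
- by move=> [t s]; rewrite /asym_add /= formNl addrNK addNr subrr.
- move=> a b c; congr pair; rewrite /= act_addr ?formDl ?formDr ?form_act.
    by rewrite !addrA [LHS](ACl (1*2*4*3)).
  rewrite (formC A _ a.1) !addrA.
  by rewrite [LHS](ACl (1*2*5*3*6*8*7*4)) (formC A _ a.1).
Qed.

Lemma asym_lambda t s t' s' :
  brace_lambda asym_add asym_opp (el t s) (t', s')
    = el (act s t') (s' - form (act s t') t).
Proof.
rewrite /brace_lambda; congr pair => /=; first by rewrite addrAC subrr add0r.
rewrite formNr formDl !addrA [LHS](ACl (1*4*2*3*5)) /= subrr add0r opprD addrA.
by rewrite addrK.
Qed.

(** As S is abelian, commutators lie in T; the left factor on the right-hand side is one, written
    out. *)
Lemma asym_swap (t t' : T) (s s' : S) :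
  (el t s * el t' s' =
   el ((t - act s' t) - (t' - act s t')) 0 * (el t' s' * el t s))%g.
Proof.
congr pair => /=; last by rewrite add0r addrC.
by rewrite act0 opprB !addrA [RHS](ACl (1*3*(2*6)*(4*5))) /= addNr addNr !addr0.
Qed.

Lemma expg_snd (x : G) n : (x ^+ n)%g.2 = x.2 *+ n.
Proof. by elim: n => // n IHn; rewrite expgS mulrS -IHn. Qed.

Lemma expg_fst (t : T) n : (el t 0 ^+ n)%g = el (t *+ n) 0.
Proof.
elim: n => // n IHn; rewrite expgS mulrS IHn.
by congr pair; rewrite /= ?act0 ?addr0.
Qed.

Lemma asym_metabelian : metabelian_group G.
Proof.
have der1_fst (x : G) : x \in [set: G]^`(1)%g -> x.2 = 0.
  suff /subsetP sub : [set: G]^`(1)%g \subset [set x : G | x.2 == 0].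
    by move=> /sub; rewrite inE => /eqP.
  have gH : group_set [set x : G | x.2 == 0].
    apply/group_setP; split; first by rewrite inE.
    by move=> u v; rewrite !inE /= => /eqP -> /eqP ->; rewrite addr0.
  rewrite derg1 -[[set x | _]]/(gval (Group gH)) gen_subG.
  apply/subsetP => _ /imset2P[u v _ _ ->]; rewrite inE.
  have comm0 (a b : S) : - a + (- b + (a + b)) = 0.
    by rewrite [a + b]addrC addKr addNr.
  exact/eqP/comm0.
rewrite /metabelian_group dergSn; apply/commG1P/centsP => -[t s] xD [t' s'] yD.
move: (der1_fst _ xD) (der1_fst _ yD) => /= -> ->.
by rewrite /commute asym_swap !act0 !subrr mul1g.
Qed.

(* A commutator of two elements of a p-subgroup lies in T and is p-torsion; it is
   also killed by the p'-part m of #|T|, because m T is p-torsion and so fixed by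
   the p-torsion of S. *)
Lemma asym_sylows_abelian :
    (forall p k s t, prime p -> s *+ (p ^ k) = 0 -> t *+ (p ^ k) = 0 ->
       act s t = t) ->
  sylows_abelian G.
Proof.
move=> act_coprime p P; rewrite inE => /and3P[_ pP _].
have [-> | ntP] := eqVneq P 1%G; first exact: abelian1.
have [p_pr _ _] := pgroup_pdiv pP ntP.
have [k oP] := p_natP pP.
apply/centsP => -[t s] xP [t' s'] yP.
have sp : s *+ (p ^ k) = 0 by rewrite -oP -(expg_snd (t, s)) expg_cardG.
have sp' : s' *+ (p ^ k) = 0 by rewrite -oP -(expg_snd (t', s')) expg_cardG.
rewrite /commute asym_swap; set d := (X in (X, 0)).
have dP : el d 0 \in P.
  by rewrite -(groupMr _ (groupM yP xP)) -asym_swap groupM.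
have dp : d *+ (p ^ k) = 0.
  by have:= expg_cardG dP; rewrite expg_fst oP => -[].
have card_mulr (u : T) : u *+ #|T| = 0.
  by rewrite -FinRing.zmodXgE -cardsT expg_cardG // inE.
have T_gt0 : (0 < #|T|)%N by apply/card_gt0P; exists 0.
have [m m_co Tml] := pfactor_coprime p_pr T_gt0; set l := logn _ _ in Tml.
have dm : d *+ m = 0.
  have fixm (u : T) v : v *+ p ^ k = 0 -> act v (u *+ m) = u *+ m.
    move=> vp; apply: (act_coprime p (k + l)%N) => //.
      by rewrite expnD mulrnA vp mul0rn.
    by rewrite -mulrnA expnD mulnCA mulnC -Tml mulrnA card_mulr mul0rn.
  by rewrite /d !mulrnBl -!act_mulrn !fixm // !subrr.
suff -> : d = 0 by rewrite mul1g.
by apply: mulrn_coprime_eq0 dp dm; rewrite coprimeXl.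
Qed.

Lemma asym_simple :
    (exists s : S, s != 0) ->
    (forall t, t != 0 -> exists t', form t t' != 0) ->
    (forall (LT : {pred T}) (LS : {pred S}),
       (forall s s', s \in LS -> s' \in LS -> s + s' \in LS) ->
       (forall t t', t \in LT -> form t t' \in LS) ->
       (forall s t, s \in LS -> act s t - t \in LT) ->
       forall s, s \in LS -> s != 0 ->
       (forall t, t \in LT) /\ (forall s', s' \in LS)) ->
  simple_brace asym_add asym_opp asym_one.
Proof.
move=> [s0 s0_neq0] form_nondeg generate; split.
  apply/card_gt1P; exists (el 0 0), (el 0 s0); split=> //.
  by apply: contraNneq s0_neq0 => -[<-].
move=> L [[[L1 LD LN] Llam] gL nL].
pose H := Group gL; have LH : L = H by [].
have [L0 | /subsetPn[[t s] tsL ts_neq0]] := boolP (L \subset [set asym_one]).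
  by left; apply/eqP; rewrite eqEsubset L0 sub1set.
right.
pose LT : {pred T} := fun t => el t 0 \in L.
pose LS : {pred S} := fun s => el 0 s \in L.
(* The additive difference of [(t1, s1)] and its image under lambda of [(t2, 0)] is
   [(0, form t1 t2)]. *)
have formL t1 s1 t2 : el t1 s1 \in L -> form t1 t2 \in LS.
  move=> t1L; have := Llam (el t2 0) _ t1L.
  rewrite asym_lambda act0 => /LN/(LD _ _ t1L).
  rewrite [X in X \in L](_ : _ = el 0 (form t1 t2)) //.
  congr pair; rewrite /= ?subrr // formNr opprB !addrA.
  by rewrite [LHS](ACl (3*(1*4)*(2*5))) /= !subrr !addr0.
(* Conjugating [(0, s1)] by [(t1, 0)] gives [(act s1 t1 - t1, 0) * (0, s1)], and L is normal. *)
have actL s1 t1 : s1 \in LS -> act s1 t1 - t1 \in LT.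
  move=> s1L; have yH : el 0 s1 \in H by [].
  change (el (act s1 t1 - t1) 0 \in H); rewrite -(groupMr _ yH).
  rewrite [X in X \in _](_ : _ = el 0 s1 ^ el t1 0)%g; last first.
    by congr pair; rewrite /= ?oppr0 ?act0 ?add0r ?addr0 // addrC.
  by rewrite memJ_norm //; apply: (subsetP (normal_norm nL)); rewrite inE.
have [s1 s1L s1_neq0] : exists2 s1, s1 \in LS & s1 != 0.
  have [t_eq0 | /form_nondeg[t' ft]] := eqVneq t 0; last first.
    by exists (form t t') => //; apply: formL tsL.
  exists s; first by rewrite unfold_in /= -t_eq0.
  by apply: contraNneq ts_neq0 => s_eq0; rewrite inE t_eq0 s_eq0.
have LSD u v : u \in LS -> v \in LS -> u + v \in LS.
  move=> uL vL; have := LD _ _ uL vL.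
  by rewrite /asym_add /= form0l !addr0.
have [LT_full LS_full] :=
  generate LT LS LSD (fun u v => @formL u 0 v) actL s1 s1L s1_neq0.
apply/setP => -[u v]; rewrite [RHS]inE.
have -> : (u, v) = (el u 0 * el 0 v)%g.
  by congr pair; rewrite /= ?act0r ?add0r ?addr0.
exact: (@groupM _ H _ _ (LT_full u) (LS_full v)).
Qed.

End AsymmetricProduct.

(** * Zero-sum functions under translation *)

Definition sum_eq0 (p q : nat) : {pred {ffun 'F_q -> 'F_p}} :=
  fun f => \sum_x f x == 0.

(** For p and q prime, this is the augmentation submodule of the regular representation of ['F_q]
    over ['F_p]. *)
Record sumzero (p q : nat) := SumZero {
  sumzero_val :> {ffun 'F_q -> 'F_p};
  sumzeroP : sumzero_val \in @sum_eq0 p q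
}.

Section SumZero.
Variables p q : nat.
Local Notation W := (sumzero p q).
Implicit Types (f g : W) (a x y : 'F_q).

Fact sum_eq0_zmod_closed : zmod_closed (@sum_eq0 p q).
Proof.
split=> [|u v]; rewrite !unfold_in.
  by rewrite big1 // => x _; rewrite ffunE.
move=> /eqP u0 /eqP v0; under eq_bigr do rewrite !ffunE.
by rewrite sumrB u0 v0 subrr.
Qed.
HB.instance Definition _ :=
  GRing.isZmodClosed.Build _ (@sum_eq0 p q) sum_eq0_zmod_closed.

HB.instance Definition _ := [isSub of W for @sumzero_val p q].
HB.instance Definition _ := [Finite of W by <:].
HB.instance Definition _ := [SubChoice_isSubZmodule of W by <:].

Lemma sumzeroE f : \sum_x f x = 0.
Proof. exact/eqP/(sumzeroP f). Qed.

Lemma sumzero_inP f g : (forall x, f x = g x) -> f = g.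
Proof. by move=> fg; apply/val_inj/ffunP. Qed.

Lemma sumzeroD f g x : (f + g) x = f x + g x.
Proof. by rewrite ffunE. Qed.

Lemma sumzeroN f x : (- f) x = - f x.
Proof. by rewrite ffunE. Qed.

Lemma sumzero0 x : (0 : W) x = 0.
Proof. by rewrite ffunE. Qed.

Fact shift_subproof a f : [ffun x => f (x + a)] \in @sum_eq0 p q.
Proof.
rewrite unfold_in; under eq_bigr do rewrite ffunE.
rewrite (reindex_inj (addIr (- a))); under eq_bigr do rewrite addrNK.
exact: sumzeroP.
Qed.
Definition shift a f : W := SumZero (shift_subproof a f).

Lemma shiftE a f x : shift a f x = f (x + a).
Proof. by rewrite ffunE. Qed.

Lemma shift0 f : shift 0 f = f.
Proof. by apply: sumzero_inP => x; rewrite shiftE addr0. Qed.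

Lemma shiftD a b f : shift (a + b) f = shift a (shift b f).
Proof. by apply: sumzero_inP => x; rewrite !shiftE addrA. Qed.

Lemma shift_add a f g : shift a (f + g) = shift a f + shift a g.
Proof. by apply: sumzero_inP => x; rewrite !(shiftE, sumzeroD). Qed.

Definition dot f g : 'F_p := \sum_x f x * g x.

Lemma dotC f g : dot f g = dot g f.
Proof. by apply: eq_bigr => x _; rewrite mulrC. Qed.

Lemma dotDl f g h : dot (f + g) h = dot f h + dot g h.
Proof. by rewrite -big_split; apply: eq_bigr => x _; rewrite sumzeroD mulrDl. Qed.

Lemma dot_shift a f g : dot (shift a f) (shift a g) = dot f g.
Proof.
rewrite [RHS](reindex_inj (addIr a)).
by apply: eq_bigr => x _; rewrite !shiftE.
Qed.

(** A difference of two point masses: pairing with it reads off a difference of values, so a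
    function orthogonal to all dipoles is constant. *)
Fact dipole_subproof x y (c : 'F_p) :
  [ffun z => c *+ (z == x) - c *+ (z == y)] \in @sum_eq0 p q.
Proof.
have sum_delta u : \sum_z c *+ (z == u) = c.
  by rewrite (bigD1 u) //= eqxx big1 ?addr0 // => z /negPf ->.
rewrite unfold_in; under eq_bigr do rewrite ffunE.
by rewrite sumrB !sum_delta subrr.
Qed.
Definition dipole x y c : W := SumZero (dipole_subproof x y c).

Lemma dot_dipole f x y c : dot f (dipole x y c) = (f x - f y) * c.
Proof.
have sum_delta u : \sum_z f z * c *+ (z == u) = f u * c.
  by rewrite (bigD1 u) //= eqxx big1 ?addr0 // => z /negPf ->.
rewrite mulrBl -!sum_delta -sumrB; apply: eq_bigr => z _.
by rewrite ffunE mulrBr !mulrnAr.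
Qed.

Lemma sumzero_neq0 : exists f, f != 0.
Proof.
exists (dipole 0 1 1); apply/eqP => /(congr1 (fun f : W => f 0)).
by rewrite sumzero0 ffunE eqxx eq_sym oner_eq0 subr0 => /eqP; rewrite oner_eq0.
Qed.

Hypothesis q_unit : #|'F_q|%:R != 0 :> 'F_p.

(** A constant c sums to q c, and q is invertible in ['F_p]. This is where the primes at the two
    ends of an edge must differ. *)
Lemma sumzero_const f : (forall x, f x = f 0) -> f = 0.
Proof.
move=> f_const; have := sumzeroE f; under eq_bigr do rewrite f_const.
rewrite sumr_const -mulr_natl => /eqP; rewrite mulf_eq0 (negPf q_unit) /=.
move=> /eqP f0.
by apply: sumzero_inP => x; rewrite f_const f0 sumzero0.
Qed.

Lemma dot_surj f r : f != 0 -> exists g, dot f g = r.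
Proof.
move=> f_neq0; have /existsP[x fx] : [exists x, f x != f 0].
  apply: contraNT f_neq0 => /existsPn f_const; apply/eqP/sumzero_const => x.
  by have /negPn/eqP := f_const x.
exists (dipole x 0 (r / (f x - f 0))).
by rewrite dot_dipole mulrCA divff ?mulr1 // subr_eq0.
Qed.

Lemma shift_fixed a f : a != 0 -> shift a f = f -> f = 0.
Proof.
move=> a_neq0 fa; apply: sumzero_const => x.
have f_an n : f (a *+ n) = f 0.
  by elim: n => // n <-; rewrite mulrSr -[in RHS]fa shiftE.
(* The natural number representing [x / a] is the multiple of [a] that reaches [x]. *)
by rewrite -(f_an (x / a : 'F_q)) -mulr_natr natr_Zp mulrCA divff ?mulr1.
Qed.

(** By [shift_fixed] the difference map is injective, hence onto since the space is finite. *)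
Lemma shift_sub_surj a g : a != 0 -> exists f, shift a f - f = g.
Proof.
move=> a_neq0; have inj_sub : injective (fun f => shift a f - f).
  move=> f1 f2 /= eq12; apply/eqP; rewrite -subr_eq0; apply/eqP/(shift_fixed a_neq0).
  apply: sumzero_inP => x; have := congr1 (fun f : W => f x) eq12.
  rewrite !(sumzeroD, sumzeroN, shiftE) => /eqP; rewrite subr_eq => /eqP ->.
  by rewrite [LHS](ACl (1*4*3*2)) /= subrr add0r.
by have /codomP[f ->] := injF_onto inj_sub g; exists f.
Qed.

(** Every function is uniquely a zero-sum function plus a constant, namely its mean, which exists
    because q is invertible. *)
Lemma card_sumzero : (#|{: W}| * #|'F_p| = #|'F_p| ^ #|'F_q|)%N.
Proof.
rewrite -card_prod -card_ffun.
pose shifted (u : W * 'F_p) : {ffun 'F_q -> 'F_p} := [ffun x => u.1 x + u.2].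
pose mean (h : {ffun 'F_q -> 'F_p}) := (\sum_x h x) / #|'F_q|%:R.
have centered (h : {ffun 'F_q -> 'F_p}) : [ffun x => h x - mean h] \in @sum_eq0 p q.
  rewrite unfold_in; under eq_bigr do rewrite ffunE.
  by rewrite sumrB sumr_const -[mean h *+ _]mulr_natr divfK ?subrr.
have mean_shifted u : mean (shifted u) = u.2.
  rewrite /mean; under eq_bigr do rewrite ffunE.
  by rewrite big_split /= sumzeroE add0r sumr_const -[u.2 *+ _]mulr_natr mulfK.
apply: (bij_eq_card (f := shifted)).
exists (fun h => (SumZero (centered h), mean h)) => [u | h].
  apply: injective_projections; rewrite /= ?mean_shifted //.
  by apply: sumzero_inP => x; rewrite /= !ffunE mean_shifted addrK.
by apply/ffunP => x; rewrite !ffunE subrK.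
Qed.

End SumZero.

(** * Direct products *)

Definition dprod (I : finType) (V : I -> finZmodType) := {dffun forall i, V i}.

Section DirectProduct.
Variables (I : finType) (V : I -> finZmodType).
Local Notation D := (dprod V).
Implicit Types f g : D.

HB.instance Definition _ := Finite.copy D {dffun forall i, V i}.

Definition dprod_add f g : D := finfun (fun i => f i + g i).
Definition dprod_opp f : D := finfun (fun i => - f i).
Definition dprod_zero : D := finfun (fun i => 0).

Fact dprod_addA : associative dprod_add.
Proof. by move=> f g h; apply/ffunP=> i; rewrite !ffunE addrA. Qed.
Fact dprod_addC : commutative dprod_add.
Proof. by move=> f g; apply/ffunP=> i; rewrite !ffunE addrC. Qed.
Fact dprod_add0 : left_id dprod_zero dprod_add.
Proof. by move=> f; apply/ffunP=> i; rewrite !ffunE add0r. Qed.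
Fact dprod_addN : left_inverse dprod_zero dprod_opp dprod_add.
Proof. by move=> f; apply/ffunP=> i; rewrite !ffunE addNr. Qed.

HB.instance Definition _ :=
  GRing.isZmodule.Build D dprod_addA dprod_addC dprod_add0 dprod_addN.
End DirectProduct.

Section DirectProductTheory.
Variables (I : finType) (V : I -> finZmodType).
Local Notation D := (dprod V).
Implicit Types f g : D.

Lemma dprodD f g i : (f + g) i = f i + g i.
Proof. by rewrite ffunE. Qed.

Lemma dprodN f i : (- f) i = - f i.
Proof. by rewrite ffunE. Qed.

Lemma dprod0 i : (0 : D) i = 0.
Proof. by rewrite ffunE. Qed.

Lemma dprod_sum (J : finType) (F : J -> D) i : (\sum_j F j) i = \sum_j F j i.
Proof.
exact: (big_morph (fun f : D => f i) (fun f g => dprodD f g i) (dprod0 i)).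
Qed.

Lemma dprodMn f n i : (f *+ n) i = f i *+ n.
Proof. by elim: n => [|n IHn]; rewrite ?dprod0 // !mulrS dprodD IHn. Qed.

Definition dinj (i : I) (x : V i) : D := finfun (dfwith (fun j => 0 : V j) x).

Arguments dinj i x : clear implicits.

Lemma dinj_in i (x : V i) : dinj i x i = x.
Proof. by rewrite ffunE dfwith_in. Qed.

Lemma dinj_out i j (x : V i) : i != j -> dinj i x j = 0.
Proof. by move=> ij; rewrite ffunE dfwith_out. Qed.

Lemma dinjD i : {morph dinj i : x y / x + y}.
Proof.
move=> x y; apply/ffunP => j; rewrite dprodD.
have [<- | ij] := eqVneq i j; first by rewrite !dinj_in.
by rewrite !dinj_out ?addr0.
Qed.

Lemma dinj0 i : dinj i 0 = 0.
Proof. by apply: (addrI (dinj i 0)); rewrite -dinjD !addr0. Qed.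

Lemma dprod_sum_dinj f : f = \sum_i dinj i (f i).
Proof.
apply/ffunP => j; rewrite dprod_sum (bigD1 j) //= dinj_in big1 ?addr0 // => i ij.
exact: dinj_out.
Qed.

Lemma dprod_neq0 f : f != 0 -> exists i, f i != 0.
Proof.
move=> f_neq0; apply/existsP; apply: contraNT f_neq0 => /existsPn f0.
by apply/eqP/ffunP => i; rewrite dprod0; apply/eqP/negPn/f0.
Qed.

Lemma card_dprod : #|{: D}| = (\prod_i #|V i|)%N.
Proof. by rewrite card_dep_ffun foldrE big_map enumT. Qed.
End DirectProductTheory.
Arguments dinj {I} V i x.

(** * The brace of a digraph *)

Lemma Fp_mulrn_char p (x : 'F_p) : prime p -> x *+ p = 0.
Proof. by move=> p_pr; apply: (mulrn_pchar (pchar_Fp p_pr)). Qed.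

Lemma natr_card_Fp_neq0 p q :
  prime p -> prime q -> p != q -> #|'F_q|%:R != 0 :> 'F_p.
Proof.
move=> p_pr q_pr neq_pq; rewrite card_Fp // -(dvdn_pcharf (pchar_Fp p_pr)).
by rewrite dvdn_prime2.
Qed.

Section Digraph.
Variables (V E : finType) (src tgt : E -> V) (pr : V -> nat).

Local Notation Sv := (fun v => 'F_(pr v) : finZmodType).
Local Notation Te := (fun e => sumzero (pr (tgt e)) (pr (src e)) : finZmodType).
Local Notation S := (dprod Sv).
Local Notation T := (dprod Te).
Local Notation injS := (dinj Sv).
Local Notation injT := (dinj Te).

Definition digraph_act (s : S) (t : T) : T :=
  finfun (fun e => shift (s (src e)) (t e)).

Definition digraph_form (t t' : T) : S :=
  \sum_e injS (tgt e) (dot (t e) (t' e)).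

Lemma digraph_actE s t e : digraph_act s t e = shift (s (src e)) (t e).
Proof. by rewrite ffunE. Qed.

Fact digraph_act0 t : digraph_act 0 t = t.
Proof. by apply/ffunP => e; rewrite digraph_actE dprod0 shift0. Qed.

Fact digraph_actD s s' t :
  digraph_act (s + s') t = digraph_act s (digraph_act s' t).
Proof. by apply/ffunP => e; rewrite !digraph_actE dprodD shiftD. Qed.

Fact digraph_act_addr s t t' :
  digraph_act s (t + t') = digraph_act s t + digraph_act s t'.
Proof.
by apply/ffunP => e; rewrite dprodD !digraph_actE dprodD shift_add.
Qed.

Fact digraph_formC t t' : digraph_form t t' = digraph_form t' t.
Proof. by apply: eq_bigr => e _; rewrite dotC. Qed.

Fact digraph_formDl t1 t2 t :
  digraph_form (t1 + t2) t = digraph_form t1 t + digraph_form t2 t.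
Proof.
by rewrite -big_split; apply: eq_bigr => e _; rewrite dprodD dotDl dinjD.
Qed.

Fact digraph_form_act s t t' :
  digraph_form (digraph_act s t) (digraph_act s t') = digraph_form t t'.
Proof. by apply: eq_bigr => e _; rewrite !digraph_actE dot_shift. Qed.

Definition digraph_datum : asym_datum T S :=
  AsymDatum digraph_act0 digraph_actD digraph_act_addr
            digraph_formC digraph_formDl digraph_form_act.

Lemma digraph_form_dinj (t : T) e (x : Te e) :
  digraph_form t (injT e x)
   = injS (tgt e) (dot (t e) x).
Proof.
rewrite /digraph_form (bigD1 e) //= dinj_in big1 ?addr0 // => e' ne.
rewrite dinj_out 1?eq_sym // dotC /dot big1 => [|y _].
  exact: dinj0.
by rewrite sumzero0 mul0r.
Qed.

Hypothesis pr_prime : forall v, prime (pr v).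
Hypothesis pr_edge : forall e, pr (tgt e) != pr (src e).

Local Notation G := (asym digraph_datum).

(** On each edge, either p is not the source prime and the p-torsion translation is 0, or p is not
    the target prime and the p-torsion vector is 0. *)
Lemma digraph_sylows_abelian : sylows_abelian G.
Proof.
apply: asym_sylows_abelian => p k s t p_pr sp tp; apply/ffunP => e.
rewrite digraph_actE.
have {}sp : s (src e) *+ (p ^ k) = 0 by rewrite -dprodMn sp dprod0.
have {}tp : t e *+ (p ^ k) = 0 by rewrite -dprodMn tp dprod0.
have co v : p != pr v -> coprime (p ^ k) (pr v).
  by move=> neq; rewrite coprimeXl // prime_coprime // dvdn_prime2.
have [eq_p | /co co_src] := eqVneq p (pr (src e)); last first.
  by rewrite (mulrn_coprime_eq0 co_src sp) ?shift0 ?Fp_mulrn_char.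
have /co co_tgt : p != pr (tgt e) by rewrite eq_p eq_sym.
suff -> : t e = 0 by apply: sumzero_inP => x; rewrite shiftE !sumzero0.
apply: mulrn_coprime_eq0 co_tgt tp _; apply: sumzero_inP => x.
rewrite sumzero0.
have -> n : (t e *+ n) x = t e x *+ n.
  by elim: n => [|n IHn]; rewrite ?sumzero0 // !mulrS sumzeroD IHn.
exact: Fp_mulrn_char.
Qed.

Let q_unit e :=
  natr_card_Fp_neq0 (pr_prime (tgt e)) (pr_prime (src e)) (pr_edge e).

Lemma card_digraph : #|{: G}| =
  ((\prod_v pr v) * \prod_e pr (tgt e) ^ (pr (src e)).-1)%N.
Proof.
rewrite [LHS]card_prod mulnC.
congr (_ * _)%N; rewrite card_dprod; apply: eq_bigr.
  by move=> v _; rewrite card_Fp.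
move=> e _; have := card_sumzero (q_unit e); rewrite !card_Fp // => cardW.
apply/eqP; rewrite -(eqn_pmul2r (prime_gt0 (pr_prime (tgt e)))).
by rewrite -expnSr prednK ?prime_gt0 // -cardW.
Qed.

Hypothesis src_surj : forall v, exists e, src e = v.
(** Strong connectivity in the form applied below to the set of vertices whose whole component lies
    in [LS]. *)
Hypothesis strongly_connected : forall A : {set V},
  A != set0 -> (forall e, src e \in A -> tgt e \in A) -> A = [set: V].

Lemma digraph_simple (v0 : V) :
  simple_brace (@asym_add _ _ digraph_datum) (@asym_opp _ _ digraph_datum)
               (asym_one digraph_datum).
Proof.
apply: asym_simple.
- exists (finfun (fun v => 1)); apply/eqP => /(congr1 (fun s : S => s v0)).
  by rewrite dprod0 ffunE => /eqP; rewrite oner_eq0.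
- move=> t /dprod_neq0[e te].
  have [g dot_g] := dot_surj (q_unit e) 1 te.
  exists (injT e g).
  rewrite [form _ _ _]digraph_form_dinj.
  apply/eqP => /(congr1 (fun s : S => s (tgt e))).
  by rewrite dinj_in dprod0 dot_g => /eqP; rewrite oner_eq0.
move=> LT LS LSD form_LS act_LT s sL s_neq0.
(* Some [z] on the edge [e] makes the [e]-component of [(s1 - 1) z] equal to a nonzero [w]; pairing
   with a suitable [g] on [e] then yields any [r]. *)
have edge s1 e r : s1 \in LS -> s1 (src e) != 0 ->
    injS (tgt e) r \in LS.
  move=> s1L s1e.
  have [w w_neq0] := sumzero_neq0 (pr (tgt e)) (pr (src e)).
  have [z def_w] := shift_sub_surj (q_unit e) w s1e.
  have [g <-] := dot_surj (q_unit e) r w_neq0.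
  rewrite -def_w.
  have := form_LS _ (injT e g) (act_LT s1 (injT e z) s1L).
  by rewrite [form _ _ _]digraph_form_dinj dprodD dprodN digraph_actE dinj_in.
pose A := [set v | [forall r, injS v r \in LS]].
have AT : A = [set: V].
  apply: strongly_connected.
    (* A nonzero component of [s] at [v] does not yet put [v] in [A], only the target of an edge
       leaving [v]. *)
    have [v sv] := dprod_neq0 s_neq0; have [e src_e] := src_surj v.
    apply/set0Pn; exists (tgt e); rewrite inE; apply/forallP => r.
    by apply: edge sL _; rewrite src_e.
  move=> e; rewrite !inE => /forallP srcA; apply/forallP => r.
  by apply: edge (srcA 1) _; rewrite dinj_in oner_eq0.
have dinjL v r : injS v r \in LS.
  by have := in_setT v; rewrite -AT inE => /forallP.
have LS_full s1 : s1 \in LS.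
  rewrite [s1]dprod_sum_dinj; elim/big_ind: _ => //.
  by rewrite -(dinj0 Sv v0).
(* All components of [s1] are nonzero, so [s1 - 1] maps T onto T and every [t] is reached in one
   step. *)
split=> // t; pose s1 : S := finfun (fun v => 1).
have /fin_all_exists[z def_t] :
    forall e, exists z : Te e, shift (s1 (src e)) z - z = t e.
  by move=> e; apply: (shift_sub_surj (q_unit e)); rewrite ffunE oner_eq0.
have := act_LT s1 (finfun z) (LS_full s1); congr (_ \in LT).
by apply/ffunP => e; rewrite dprodD dprodN digraph_actE -[RHS]def_t !ffunE.
Qed.

End Digraph.

Local Close Scope ring_scope.

(** * Cyclically layered digraphs *)

Lemma prod_tagged (I : finType) (N F : I -> nat) :
  (\prod_(x : {i : I & 'I_(N i)}) F (tag x) = \prod_i F i ^ N i).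
Proof.
rewrite -(sig_big_dep xpredT (fun _ => xpredT) (fun i (_ : 'I_(N i)) => F i)) /=.
by apply: eq_bigr => i _; rewrite prod_nat_const card_ord.
Qed.

Lemma ordS_neq n (i : 'I_n) : (1 < n) -> ordS i != i.
Proof.
move=> n_gt1; apply/eqP => /(congr1 val) /=.
have [i_lt | ] := ltnP i.+1 n.
  by rewrite modn_small // => /eqP; rewrite eqn_leq ltnn.
rewrite leq_eqVlt ltnS leqNgt ltn_ord orbF => /eqP n_eq.
by rewrite -n_eq modnn => i0; rewrite n_eq -i0 in n_gt1.
Qed.

Lemma val_iter_ordS n (i : 'I_n) t : val (iter t (@ordS n) i) = ((i + t) %% n).
Proof.
elim: t => [|t IHt]; first by rewrite addn0 modn_small.
by rewrite iterS [LHS]/= IHt addnS -addn1 modnDml addn1.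
Qed.

Lemma iter_ordS_onto n (i j : 'I_n) : exists t, iter t.+1 (@ordS n) i = j.
Proof.
(* Advancing by [j + (n - i)] leads from i to j modulo n. It is positive even for i = j: a full turn
   is what fills the starting layer. *)
exists (j + (n - i)).-1; rewrite prednK; last first.
  by rewrite addn_gt0 subn_gt0 ltn_ord orbT.
apply: val_inj; rewrite val_iter_ordS addnCA subnKC ?(ltnW (ltn_ord i)) //.
by rewrite modnDr modn_small.
Qed.

(* Layer i has (K i).+1 vertices, so that inord never meets an empty type. *)
Section CyclicDigraph.
Variables (n : nat) (K N : 'I_n -> nat).

Local Notation layer := (fun i => 'I_(K i).+1).
Local Notation V := {i : 'I_n & 'I_(K i).+1}.
Local Notation E := {i : 'I_n & 'I_(N i)}.

(** An edge number is read in base [(K i).+1]: the remainder is the source and the quotient the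
    target, so the lowest numbers list every pair once. For surplus edges the quotient is out of
    range, and [inord] sends the target to vertex 0. *)
Definition cyc_src (e : E) : V :=
  Tagged layer (inord (tagged e %% (K (tag e)).+1) : layer (tag e)).
Definition cyc_tgt (e : E) : V :=
  Tagged layer (inord (tagged e %/ (K (tag e)).+1) : layer (ordS (tag e))).

Hypothesis enough_edges : forall i, ((K i).+1 * (K (ordS i)).+1 <= N i).

Lemma cyc_edge i (a : layer i) (b : layer (ordS i)) :
  exists e, cyc_src e = Tagged layer a /\ cyc_tgt e = Tagged layer b.
Proof.
have x_lt : (b * (K i).+1 + a < N i).
  apply: leq_trans (enough_edges i); rewrite (mulnC (K i).+1).
  by rewrite -ltn_divLR // divnMDl // divn_small // addn0.
exists (Tagged (fun i => 'I_(N i)) (Ordinal x_lt)); split; congr Tagged => /=.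
  by rewrite modnMDl modn_small // inord_val.
by rewrite divnMDl // divn_small // addn0 inord_val.
Qed.

Lemma cyc_src_surj v : exists e, cyc_src e = v.
Proof.
by case: v => i a; have [e [src_e _]] := cyc_edge a ord0; exists e.
Qed.

Lemma cyc_strongly_connected (A : {set V}) :
  A != set0 -> (forall e, cyc_src e \in A -> cyc_tgt e \in A) -> A = [set: V].
Proof.
case/set0Pn => -[i a] aA edgeA.
have step j (c : layer j) : Tagged layer c \in A ->
    forall b : layer (ordS j), Tagged layer b \in A.
  by move=> cA b; have [e [src_e <-]] := cyc_edge c b; apply: edgeA; rewrite src_e.
have fullA t (b : layer (iter t.+1 (@ordS n) i)) : Tagged layer b \in A.
  elim: t b => [|t IHt] b; first exact: step aA b.
  exact: step (IHt ord0) b.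
apply/setP => -[j b]; rewrite [RHS]inE.
by have [t def_j] := iter_ordS_onto i j; case: _ / def_j in b *; apply: fullA.
Qed.

End CyclicDigraph.

(** * Choice of the layer sizes and edge numbers for given exponents *)

Theorem theorem1p1 (n : nat) (p : 'I_n -> nat)
    (hn : 1 < n)
    (hp : forall i, prime (p i))
    (hinj : injective p) :
  exists l : 'I_n -> nat,
    (forall i, 0 < l i) /\
    forall m : 'I_n -> nat, (forall i, l i <= m i) ->
      exists (gT : finGroupType) (add : gT -> gT -> gT) (opp : gT -> gT)
             (zero : gT),
        [/\ is_left_brace add opp zero,
            simple_brace add opp zero,
            #|gT| = \prod_(i < n) p i ^ m i,
            metabelian_group gT &
            sylows_abelian gT].
Proof.
(* Consecutive layers have at most P vertices each and [d i <= P], so [m - 1 >= P ^ 3] makes the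
   quotient by [d i] at least the number of pairs to join. *)
pose P := \max_i p i; exists (fun=> (P * P * P).+1); split=> // m m_ge.
pose d i := (p i).-1.
have d_gt0 i : (0 < d i) by rewrite /d; case: (p i) (prime_gt1 (hp i)) => [|[]].
have d_le i : (d i <= P) by apply: leq_trans (leq_pred _) (leq_bigmax i).
(* Euclidean division of [m j - 1] by [d (ord_pred j)]: subtracting 1 first leaves room for the at
   least one vertex of layer j. [N] is indexed by the layer its edges leave, hence [ordS]. *)
pose K j := ((m j).-1 %% d (ord_pred j)).
pose N i := ((m (ordS i)).-1 %/ d i).
have K_le i : ((K i).+1 <= P).
  by apply: leq_trans (d_le (ord_pred i)); rewrite ltn_pmod.
have enough i : ((K i).+1 * (K (ordS i)).+1 <= N i).
  apply: leq_trans (leq_mul (K_le i) (K_le _)) _; rewrite leq_divRL //.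
  apply: leq_trans (leq_mul (leqnn _) (d_le i)) _.
  by rewrite -ltnS prednK // (leq_trans _ (m_ge _)).
pose pr (v : {i : 'I_n & 'I_(K i).+1}) := p (tag v).
pose D := digraph_datum (@cyc_src n K N) (@cyc_tgt n K N) pr.
have pr_prime v : prime (pr v) := hp (tag v).
have pr_edge e : pr (@cyc_tgt n K N e) != pr (@cyc_src n K N e).
  by rewrite (inj_eq hinj) ordS_neq.
exists (asym D), (@asym_add _ _ D), (@asym_opp _ _ D), (asym_one D); split.
- exact: asym_is_left_brace.
- apply: digraph_simple => //.
  + exact: cyc_src_surj.
  + exact: cyc_strongly_connected.
  + exact: (Tagged (fun i => 'I_(K i).+1)
                (ord0 : 'I_(K (Ordinal (ltnW hn))).+1)).
- rewrite card_digraph // prod_tagged.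
  rewrite (prod_tagged N (fun i => p (ordS i) ^ d i)).
  (* The edges are regrouped by the layer they enter, so that both products have base [p i] and the
     exponents add up by the division identity. *)
  rewrite [X in (_ * X)](reindex_inj (can_inj (@ord_predK n))) -big_split.
  apply: eq_bigr => i _; rewrite /= ord_predK -expnM -expnD /N ord_predK mulnC.
  by rewrite addSn addnC -divn_eq prednK // (leq_trans _ (m_ge _)).
- exact: asym_metabelian.
- exact: digraph_sylows_abelian.
Qed.
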